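(* There is an absolute constant $C>0$ such that the following holds. Let $n\ge 1$, let $\vec p=(\vec p_i)_{i=1}^n$ be a set of $n$ red points and $\vec q=(\vec q_i)_{i=1}^n$ a set of $n$ blue points in the Euclidean plane $\mathbb{E}^2$, all $2n$ points distinct. Let $r$ be the maximum, over all lines $\ell$ passing through at least two points of $\vec p\cup\vec q$, of the number of points of $\vec p\cup \vec q$ lying on $\ell$. Then the number of bichromatic lines satisfies $\card{\mathcal{B}(\vec p,\vec q)}\ge C\, n(2n-r)$.
   Context: For a bichromatic point set $(\vec p,\vec q)$ (red points $\vec p$, blue points $\vec q$), $\mathcal{B}(\vec p,\vec q)$ denotes the set of lines in $\mathbb{E}^2$ that pass through at least one red point and at least one blue point (equivalently, the set of distinct lines $\vec p_i\vec q_j$). The richness of a line is the number of points of $\vec p\cup\vec q$ incident to it. *)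

(* Defs.v *)
From mathcomp Require Export all_boot all_order all_algebra finmap.
From mathcomp Require Export boolp classical_sets cardinality reals.

Set Implicit Arguments.
Unset Strict Implicit.
Unset Printing Implicit Defensive.

Import Order.TTheory GRing.Theory Num.Theory.

Local Open Scope classical_set_scope.
Local Open Scope ring_scope.

Section Lines.
Variable R : realType.
Implicit Types (L : set 'rV[R]_2) (n : nat).

Definition is_line L : Prop :=
  exists a v : 'rV[R]_2, v != 0 /\ L = [set a + t *: v | t in [set: R]].

Definition points n (p q : 'I_n -> 'rV[R]_2) : set 'rV[R]_2 :=
  range p `|` range q.

(* [fset_set A] is the finite set underlying [A] when [A] is finite (and the
   empty one otherwise); [points p q] is always finite. *)
Definition richness n (p q : 'I_n -> 'rV[R]_2) L : nat :=
  #|` fset_set (points p q `&` L)|.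

Definition is_max_richness n (p q : 'I_n -> 'rV[R]_2) (r : nat) : Prop :=
  (exists L, [/\ is_line L, (2 <= richness p q L)%N & richness p q L = r]) /\
  (forall L, is_line L -> (2 <= richness p q L)%N -> (richness p q L <= r)%N).

Definition bichromatic_lines n (p q : 'I_n -> 'rV[R]_2) :
    set (set 'rV[R]_2) :=
  [set L | [/\ is_line L, exists i, L (p i) & exists j, L (q j)]].

Lemma finite_points n (p q : 'I_n -> 'rV[R]_2) : finite_set (points p q).
Proof.
by rewrite /points finite_setU; split; apply: finite_image; apply: finite_finset.
Qed.

Lemma line_through L (x y : 'rV[R]_2) : is_line L -> x <> y -> L x -> L y ->
  L = [set x + t *: (y - x) | t in [set: R]].
Proof.
move=> [a [v [v0 ->]]] xy [s _ sx] [t _ ty].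
have st : t - s != 0.
  by apply/eqP => /eqP; rewrite subr_eq0 => /eqP ts; apply: xy; rewrite -sx -ty ts.
have yx : y - x = (t - s) *: v by rewrite -sx -ty opprD addrACA subrr add0r scalerBl.
rewrite yx; apply/seteqP; split => z /= [u _ <-].
- exists ((u - s) / (t - s)) => //.
  by rewrite scalerA divfK // -sx -addrA -scalerDl [s + _]addrC subrK.
- exists (s + u * (t - s)) => //.
  by rewrite -sx scalerA -addrA -scalerDl.
Qed.

(* For disjoint colour classes [fset_set (bichromatic_lines p q)] is thus the
   genuine finite set of bichromatic lines. *)
Lemma finite_bichromatic_lines n (p q : 'I_n -> 'rV[R]_2) :
  (forall i j, p i <> q j) -> finite_set (bichromatic_lines p q).
Proof.
move=> pq; pose f (ij : 'I_n * 'I_n) : set 'rV[R]_2 :=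
  [set p ij.1 + t *: (q ij.2 - p ij.1) | t in [set: R]].
apply: (@sub_finite_set _ _ (range f)); last first.
  by apply: finite_image; apply: finite_finset.
move=> L [lL [i Li] [j Lj]]; exists (i, j) => //=.
by rewrite /f /= -(line_through lL (pq i j) Li Lj).
Qed.

End Lines.

(* Main.v *)
Require Import Defs.
From mathcomp Require Import all_boot all_order all_algebra.
From mathcomp Require Import ring lra zify.

(** If some line [l] carries a positive proportion of the points, one of the
    colours has at least half of the points of [l] and the other one at least
    half of the points off [l]; joining them greedily gives the bound, because
    each new point off [l] repeats at most one line per earlier point.

    Otherwise it suffices that the lines with at least [k] points carry few
    pairs of points, [k] being an absolute constant. Instead of the
    Szemeredi-Trotter theorem we use a cell argument of constant depth. Every
    finite set [Q] has three disjoint subsets of size [|Q| / 12] such that all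
    lines but one miss one of them: cut [Q] into three vertical slabs, cut the
    outer two in a balanced way by a line [h], and take the parts of the outer
    slabs on one side of [h] and the part of the middle slab on the other side.
    By a weighted Cauchy-Schwarz inequality, each subdivision improves the
    trivial bound [|Q|^2] on the sum of [|l :&: Q|^2] over the lines by a
    constant factor, at the price of larger multiples of the number of
    incidences (negligible when all lines are [k]-rich) and of the size of the
    exceptional lines (negligible when no line is too rich). *)

Set Implicit Arguments.
Unset Strict Implicit.
Unset Printing Implicit Defensive.

Import Order.TTheory GRing.Theory Num.Theory.

Local Open Scope ring_scope.

(** * Order statistics of a function on a finite set *)

Section Quantiles.
Variables (R : realFieldType) (T : finType).
Implicit Types (f : T -> R) (Q A : {set T}).

(** Moving minimisers of [f] on the remaining set into [A] one at a time reaches every cardinality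
    exactly, even when [f] has ties and no sublevel set has that size. *)
Lemma initial_part f Q m : (m <= #|Q|)%N ->
  exists A, [/\ A \subset Q, #|A| = m &
    forall s t, s \in A -> t \in Q :\: A -> f s <= f t].
Proof.
elim: m => [|m IH] le_mQ.
  by exists finset.set0; split; rewrite ?sub0set ?cards0 // => s t; rewrite inE.
have [A [sAQ cA leA]] := IH (ltnW le_mQ).
have /card_gt0P[t0 t0Q] : (0 < #|Q :\: A|)%N.
  by have := cardsID A Q; rewrite (finset.setIidPr sAQ); lia.
case: (arg_minP f t0Q) => t tQA mint.
have : t \in Q :\: A by [].
rewrite inE => /andP[tA tQ].
exists (t |: A); split.
- by rewrite subUset sub1set tQ.
- by rewrite cardsU1 tA cA.
- move=> s u; rewrite !inE negb_or => /orP[/eqP->|sA] /andP[/andP[_ uA] uQ].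
    by apply: mint; suff: u \in Q :\: A by []; rewrite inE uA.
  by apply: leA; rewrite // inE uA.
Qed.

Lemma quantile f Q m : (0 < m <= #|Q|)%N -> exists b,
  (m <= #|[set s in Q | (f s <= b)%R]|)%N /\
  (#|Q| - m <= #|[set s in Q | (b <= f s)%R]|)%N.
Proof.
case/andP=> m_gt0 le_mQ; have [A [sAQ cA leA]] := initial_part f le_mQ.
have /card_gt0P[s0 s0A] : (0 < #|A|)%N by rewrite cA.
(* The threshold is the largest value of [f] on the initial part [A]. *)
case: (arg_maxP f s0A) => s sA maxs; exists (f s); split.
  rewrite -cA; apply/subset_leq_card/fintype.subsetP => t tA.
  by rewrite inE (fintype.subsetP sAQ) //=; apply: maxs.
have <- : #|Q :\: A| = (#|Q| - m)%N.
  by rewrite cardsD (finset.setIidPr sAQ) cA.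
apply/subset_leq_card/fintype.subsetP => t tA; rewrite inE leA // andbT.
by move: tA; rewrite inE => /andP[].
Qed.

Lemma subset_of_card Q m : (m <= #|Q|)%N -> exists2 A : {set T}, A \subset Q & #|A| = m.
Proof. by move=> /(initial_part (fun=> 0))[A [sAQ cA _]]; exists A. Qed.

(** Double counting. A compared pair has its first entry above [b], which happens for at most
    [v * (4 * v)] pairs, or both entries at most [b], which leaves [4 * v] choices for each element
    of [Y]. Together these must reach [8 * v ^ 2]. *)
Lemma quantile_of_comparisons f (L1 L2 : {set T}) b v :
  (0 < v)%N -> #|L1| = (4 * v)%N -> #|L2| = (4 * v)%N ->
  (8 * v ^ 2 <= #|[set u in finset.setX L1 L2 | (f u.2 <= f u.1)%R]|)%N ->
  (3 * v <= #|[set s in L1 | (f s <= b)%R]|)%N ->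
  (v <= #|[set s in L2 | (f s <= b)%R]|)%N.
Proof.
move=> v0 c1 c2 cp c3.
set X := [set s in L1 | _] in c3 *; set Y := [set s in L2 | _].
have : (#|[set u in finset.setX L1 L2 | (f u.2 <= f u.1)%R]|
        <= #|finset.setX (L1 :\: X) L2 :|: finset.setX L1 Y|)%N.
  apply/subset_leq_card/fintype.subsetP => -[s t]; rewrite !inE /=.
  case/andP=> /andP[-> ->] le_ts /=.
  by case: (lerP (f s) b) => //= le_sb; rewrite (le_trans le_ts le_sb).
have := leq_card_setU (finset.setX (L1 :\: X) L2) (finset.setX L1 Y).
rewrite !cardsX cardsD c1 c2.
have -> : L1 :&: X = X.
  by apply/finset.setIidPr/fintype.subsetP => s; rewrite inE => /andP[].
move=> leU /(leq_trans cp)/leq_trans/(_ leU) le8.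
have le1 : ((4 * v - #|X|) * (4 * v) <= v * (4 * v))%N by rewrite leq_mul2r; lia.
rewrite -(leq_pmul2l v0); move: (leq_trans le8 (leq_add le1 (leqnn _))).
by rewrite mulnn; nia.
Qed.

End Quantiles.

(** * Lines as subsets of the index set, and three cells that all lines but one fail to meet
    together *)

Section Lines.
Variables (R : realFieldType) (T : finType) (x y : T -> R).
Hypothesis x_inj : injective x.
Implicit Types (a b : R) (Q : {set T}) (F : {set {set T}}).

(** Only non-vertical lines have this form. As [x] is injective, a vertical line would hold at most
    one index. *)
Definition graph_line a b : {set T} := [set u | y u == a * x u + b].

(** Collinearity as a vanishing determinant: it avoids division, covers vertical pairs and is
    invariant under shears. *)
Definition span_line s t : {set T} :=
  [set u | (x t - x s) * (y u - y s) == (y t - y s) * (x u - x s)].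

Lemma span_lineP s t : s != t -> exists a b, span_line s t = graph_line a b.
Proof.
move=> neq_st; have dx : x t - x s != 0.
  by rewrite subr_eq0; apply: contra neq_st => /eqP/x_inj->.
exists ((y t - y s) / (x t - x s)), (y s - (y t - y s) / (x t - x s) * x s).
apply/setP => u; rewrite !inE; apply/eqP/eqP => [e|->]; last by field.
apply: (mulfI dx); rewrite !mulrDr mulrN !mulrA.
have -> : (x t - x s) * (y t - y s) / (x t - x s) = y t - y s by field.
by move: e; lra.
Qed.

Lemma graph_line_inj a b a' b' s t : s != t ->
  s \in graph_line a b -> t \in graph_line a b ->
  s \in graph_line a' b' -> t \in graph_line a' b' -> a = a' /\ b = b'.
Proof.
move=> neq_st; rewrite !inE => /eqP e1 /eqP e2 /eqP e3 /eqP e4.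
have dx : x t - x s != 0.
  by rewrite subr_eq0; apply: contra neq_st => /eqP/x_inj->.
have eq_a : a = a'.
  by apply: (mulIf dx); move: e1 e2 e3 e4; lra.
by split=> //; move: e1 e3; rewrite eq_a; lra.
Qed.

Lemma mem_span_line s t : (s \in span_line s t) * (t \in span_line s t).
Proof. by rewrite !inE !subrr !mulr0 eqxx mulrC eqxx. Qed.

Lemma graph_line_span a b s t : s != t ->
  s \in graph_line a b -> t \in graph_line a b -> graph_line a b = span_line s t.
Proof.
move=> neq_st sL tL; have [a' [b' E]] := span_lineP neq_st.
have [sl tl] := mem_span_line s t; rewrite E in sl tl *.
by have [-> ->] := graph_line_inj neq_st sL tL sl tl.
Qed.

Lemma span_line_eq s t u v : s != t -> u != v ->
  u \in span_line s t -> v \in span_line s t -> span_line s t = span_line u v.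
Proof.
by move=> /span_lineP[a [b ->]]; apply: graph_line_span.
Qed.

(* A chord from the part of the left slab below [y = a x + b] to the part of
   the right slab below it passes strictly below it in between. *)
Lemma graph_line_between a b a' b' s t u : x s < x t -> x t < x u ->
  s \in graph_line a' b' -> t \in graph_line a' b' -> u \in graph_line a' b' ->
  (y s - a * x s <= b /\ b <= y t - a * x t /\ y u - a * x u <= b) \/
  (b <= y s - a * x s /\ y t - a * x t <= b /\ b <= y u - a * x u) ->
  a = a' /\ b = b'.
Proof.
move=> st tu; rewrite !inE => /eqP-> /eqP-> /eqP-> H.
have eq_a : a = a'.
  apply/eqP; case: (ltgtP a a') => // lt; exfalso; case: H => -[h1 [h2 h3]].
  - have : 0 < (a' - a) * (x u - x t) by rewrite mulr_gt0 ?subr_gt0.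
    by move: h2 h3; lra.
  - have : 0 < (a' - a) * (x t - x s) by rewrite mulr_gt0 ?subr_gt0.
    by move: h2 h1; lra.
  - have : 0 < (a - a') * (x t - x s) by rewrite mulr_gt0 ?subr_gt0.
    by move: h2 h1; lra.
  - have : 0 < (a - a') * (x u - x t) by rewrite mulr_gt0 ?subr_gt0.
    by move: h2 h3; lra.
split=> //; move: H; rewrite eq_a.
by move=> [[h1 [h2 h3]]|[h1 [h2 h3]]]; move: h1 h2 h3; lra.
Qed.

Lemma slabs Q w : (3 * w <= #|Q|)%N -> exists Q1 Q2 Q3 : {set T},
  [/\ Q1 \subset Q, Q2 \subset Q & Q3 \subset Q] /\
  [/\ #|Q1| = w, #|Q2| = w, #|Q3| = w,
      forall s t, s \in Q1 -> t \in Q2 -> x s < x t &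
      forall s t, s \in Q2 -> t \in Q3 -> x s < x t].
Proof.
move=> wQ.
have lt_x (A B : {set T}) :
    (forall s t, s \in A -> t \in B :\: A -> x s <= x t) ->
  forall s t, s \in A -> t \in B :\: A -> x s < x t.
  move=> le_x s t sA tB; rewrite lt_neqAle le_x // andbT.
  by apply/eqP => /x_inj e; move: tB; rewrite inE -e sA.
have [|Q1 [s1 c1 /lt_x l1]] := @initial_part R T x Q w; first lia.
have c1' : #|Q :\: Q1| = (#|Q| - w)%N by rewrite cardsD (finset.setIidPr s1) c1.
have [|Q2 [s2 c2 /lt_x l2]] := @initial_part R T x (Q :\: Q1) w; first lia.
have c2' : #|Q :\: Q1 :\: Q2| = (#|Q| - w - w)%N.
  by rewrite cardsD (finset.setIidPr s2) c1' c2.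
have [|Q3 s3 c3] := @subset_of_card R T (Q :\: Q1 :\: Q2) w; first lia.
exists Q1, Q2, Q3; split; first split => //.
- exact: fintype.subset_trans s2 (subsetDl _ _).
- apply: fintype.subset_trans s3 _.
  exact: fintype.subset_trans (subsetDl _ _) (subsetDl _ _).
split => // s t sA tB; first by apply: l1 => //; apply: (fintype.subsetP s2).
by apply: l2 => //; apply: (fintype.subsetP s3).
Qed.

(* A ham-sandwich cut up to constants: the median slope of the segments from
   [L1] to [L2] balances the comparisons of intercepts between both sets. *)
Lemma balanced_cut (L1 L2 : {set T}) v :
  (0 < v)%N -> #|L1| = (4 * v)%N -> #|L2| = (4 * v)%N ->
  (forall s t, s \in L1 -> t \in L2 -> x s < x t) ->
  exists a b : R,
  [/\ (v <= #|[set s in L1 | (y s - a * x s <= b)%R]|)%N,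
      (v <= #|[set s in L1 | (b <= y s - a * x s)%R]|)%N,
      (v <= #|[set s in L2 | (y s - a * x s <= b)%R]|)%N &
      (v <= #|[set s in L2 | (b <= y s - a * x s)%R]|)%N].
Proof.
move=> v0 c1 c2 lt_x.
pose sl (u : T * T) := (y u.2 - y u.1) / (x u.2 - x u.1).
(* [a] is a median of the [16 * v ^ 2] slopes. A slope at most [a] means that the intercept [f] does
   not increase from [s] to [t], so each direction of comparison holds for at least half of the
   pairs. *)
have [|a [a1 a2]] := @quantile R _ sl (finset.setX L1 L2) (8 * v ^ 2).
  by rewrite cardsX c1 c2; nia.
pose f s := y s - a * x s.
have h1 : (8 * v ^ 2 <= #|[set u in finset.setX L1 L2 | (f u.2 <= f u.1)%R]|)%N.
  apply: (leq_trans a1); apply/subset_leq_card/fintype.subsetP => -[s t].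
  rewrite !inE /= /sl /f /= => /andP[/andP[sL tL]]; rewrite sL tL /=.
  by rewrite ler_pdivrMr ?subr_gt0 ?lt_x //; lra.
have h2 : (8 * v ^ 2 <= #|[set u in finset.setX L2 L1 | (f u.2 <= f u.1)%R]|)%N.
  have le : (8 * v ^ 2 <= #|[set u in finset.setX L1 L2 | (f u.1 <= f u.2)%R]|)%N.
    apply: (@leq_trans (#|finset.setX L1 L2| - 8 * v ^ 2)).
      by rewrite cardsX c1 c2; nia.
    apply: (leq_trans a2); apply/subset_leq_card/fintype.subsetP => -[s t].
    rewrite !inE /= /sl /f /= => /andP[/andP[sL tL]]; rewrite sL tL /=.
    by rewrite ler_pdivlMr ?subr_gt0 ?lt_x //; lra.
  apply: (leq_trans le).
  have sw_inj : injective (fun u : T * T => (u.2, u.1)) by move=> [? ?] [? ?] [-> ->].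
  rewrite -(card_imset _ sw_inj); apply/subset_leq_card/fintype.subsetP => u.
  case/imsetP=> -[s t]; rewrite !inE /= => /andP[/andP[sL tL] le_f] ->.
  by rewrite /= tL sL.
have [|b1 [q1 q1']] := @quantile R _ f L1 (3 * v); first by lia.
have [|b2 [q2 q2']] := @quantile R _ f L2 (3 * v); first by lia.
have {}q1' : (v <= #|[set s in L1 | (b1 <= f s)%R]|)%N by lia.
have {}q2' : (v <= #|[set s in L2 | (b2 <= f s)%R]|)%N by lia.
(* The smaller of the two quantiles serves both sets: the comparisons give enough points below it in
   the other set, and the points of that set above the larger quantile are above it too. *)
exists a; case: (lerP b1 b2) => le_b.
- exists b1; split => //; first by apply: leq_trans q1; lia.
    exact: (quantile_of_comparisons v0 c1 c2 h1 q1).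
  apply: (leq_trans q2'); apply/subset_leq_card/fintype.subsetP => s.
  by rewrite !inE => /andP[-> /(le_trans le_b)->].
- exists b2; split => //; last by apply: leq_trans q2; lia.
    exact: (quantile_of_comparisons v0 c2 c1 h2 q2).
  apply: (leq_trans q1'); apply/subset_leq_card/fintype.subsetP => s.
  by rewrite !inE => /andP[-> /(le_trans (ltW le_b))->].
Qed.

Definition misses (l A : {set T}) := l :&: A == finset.set0.

Lemma line_avoiding_triple Q v : (0 < v)%N -> (12 * v <= #|Q|)%N ->
  exists (A B C h : {set T}),
  [/\ A \subset Q, B \subset Q & C \subset Q] /\
  [/\ #|A| = v, #|B| = v & #|C| = v] /\
  [/\ [disjoint A & B], [disjoint A & C] & [disjoint B & C]] /\
  forall a b, graph_line a b != h ->
    [\/ misses (graph_line a b) A, misses (graph_line a b) B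
      | misses (graph_line a b) C].
Proof.
move=> v0 vQ.
(* Slabs of size [4 * v], so that the balanced cut leaves [v] points of each outer slab on both of
   its sides. *)
have [|L1 [M [L2 [[s1 sM s2] [c1 cM c2 lt1 lt2]]]]] := @slabs Q (4 * v); first lia.
have lt12 s t : s \in L1 -> t \in L2 -> x s < x t.
  move=> sL tL; have /card_gt0P[u uM] : (0 < #|M|)%N by lia.
  by apply: lt_trans (lt1 _ _ sL uM) (lt2 _ _ uM tL).
have [a [b [k1 k2 k3 k4]]] := balanced_cut v0 c1 c2 lt12.
(* [P1] is the closed side of the cut for the two outer cells and [P2] the side for the middle one.
   Both assignments of sides occur below. *)
have key (P1 P2 : pred T) :
    (v <= #|[set s in L1 | P1 s]|)%N -> (v <= #|[set s in M | P2 s]|)%N ->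
    (v <= #|[set s in L2 | P1 s]|)%N ->
    (forall a' b' s t u, P1 s -> P2 t -> P1 u -> x s < x t -> x t < x u ->
      s \in graph_line a' b' -> t \in graph_line a' b' ->
      u \in graph_line a' b' -> a = a' /\ b = b') ->
  exists (A B C h : {set T}),
  [/\ A \subset Q, B \subset Q & C \subset Q] /\
  [/\ #|A| = v, #|B| = v & #|C| = v] /\
  [/\ [disjoint A & B], [disjoint A & C] & [disjoint B & C]] /\
  forall a b, graph_line a b != h ->
    [\/ misses (graph_line a b) A, misses (graph_line a b) B
      | misses (graph_line a b) C].
  move=> /(subset_of_card R)[A sA cA] /(subset_of_card R)[B sB cB].
  move=> /(subset_of_card R)[C sC cC] H.
  have mA s : s \in A -> s \in L1 /\ P1 s.
    by move/(fintype.subsetP sA); rewrite inE => /andP.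
  have mB s : s \in B -> s \in M /\ P2 s.
    by move/(fintype.subsetP sB); rewrite inE => /andP.
  have mC s : s \in C -> s \in L2 /\ P1 s.
    by move/(fintype.subsetP sC); rewrite inE => /andP.
  have disj (X Y : {set T}) : (forall s t, s \in X -> t \in Y -> x s < x t) ->
      [disjoint X & Y].
    move=> lt; rewrite -setI_eq0; apply/eqP/setP => s; rewrite !inE.
    by apply/andP => -[/lt h /h]; rewrite ltxx.
  exists A, B, C, (graph_line a b); split.
    split; apply/fintype.subsetP => s.
    - by move/mA => [/(fintype.subsetP s1)].
    - by move/mB => [/(fintype.subsetP sM)].
    - by move/mC => [/(fintype.subsetP s2)].
  split=> //; split.
    split; apply: disj => s t.
    - by move=> /mA[? _] /mB[? _]; apply: lt1.
    - by move=> /mA[? _] /mC[? _]; apply: lt12.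
    - by move=> /mB[? _] /mC[? _]; apply: lt2.
  move=> a' b' neq; rewrite /misses.
  case: (set_0Vmem (graph_line a' b' :&: A)) => [->|[s]].
    by constructor 1.
  case: (set_0Vmem (graph_line a' b' :&: B)) => [->|[t]].
    by constructor 2.
  case: (set_0Vmem (graph_line a' b' :&: C)) => [->|[u]].
    by constructor 3.
  rewrite !in_setI => /andP[ul /mC[uC Pu]] /andP[tl /mB[tB Pt]] /andP[sl /mA[sA' Ps]].
  have [ea eb] := H a' b' s t u Ps Pt Pu (lt1 _ _ sA' tB) (lt2 _ _ tB uC) sl tl ul.
  by rewrite ea eb eqxx in neq.
pose f s := y s - a * x s.
(* Either side of the cut may be short of points of the middle slab, but not both; the middle cell
   takes a side with at least [v] of them. *)
case: (leqP v #|[set s in M | (b <= f s)%R]|) => cb.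
  apply: (key (fun s => f s <= b) (fun s => b <= f s)) => //.
  move=> a' b' s t u Ps Pt Pu st tu sl tl ul.
  by apply: (@graph_line_between a b a' b' s t u) => //; left.
apply: (key (fun s => b <= f s) (fun s => f s <= b)) => //.
  have sub : M \subset [set s in M | (b <= f s)%R] :|: [set s in M | (f s <= b)%R].
    apply/fintype.subsetP => s sM'; rewrite !inE sM' /=.
    by case: (lerP b (f s)) => // /ltW.
  have := leq_trans (subset_leq_card sub) (leq_card_setU _ _).
  lia.
move=> a' b' s t u Ps Pt Pu st tu sl tl ul.
by apply: (@graph_line_between a b a' b' s t u) => //; right.
Qed.

End Lines.

(** * Sums of squared line sizes and their decay under subdivision *)

Lemma weighted_cauchy3 (R : realFieldType) (b c d v w : R) : 0 < v -> 0 < w ->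
  (b + c + d) ^+ 2 <= (2 * v + w) * (b ^+ 2 / v + c ^+ 2 / v + d ^+ 2 / w).
Proof.
move=> v0 w0; rewrite -subr_ge0.
(* Lagrange's identity for the weights [v], [v], [w]. *)
have -> : (2 * v + w) * (b ^+ 2 / v + c ^+ 2 / v + d ^+ 2 / w) - (b + c + d) ^+ 2
    = (b - c) ^+ 2 + (b * w - d * v) ^+ 2 / (v * w)
      + (c * w - d * v) ^+ 2 / (v * w).
  by field; rewrite !gt_eqF.
by rewrite !addr_ge0 ?divr_ge0 ?sqr_ge0 ?mulr_ge0 ?ltW.
Qed.

Section RichPairs.
Variables (R : realFieldType) (T : finType).
Implicit Types (l Q A B C D : {set T}) (F : {set {set T}}).

Definition sum_sq F Q : R := \sum_(l in F) (#|l :&: Q|%:R) ^+ 2.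
Definition incidences F Q : R := \sum_(l in F) #|l :&: Q|%:R.

Lemma cardsI_split4 Q A B C l :
  A \subset Q -> B \subset Q -> C \subset Q ->
  [disjoint A & B] -> [disjoint A & C] -> [disjoint B & C] ->
  #|l :&: Q| = (#|l :&: A| + #|l :&: B| + #|l :&: C|
    + #|l :&: (Q :\: A :\: B :\: C)|)%N.
Proof.
move=> sA sB sC dAB dAC dBC.
have splitI (X Y : {set T}) : Y \subset X ->
    #|l :&: X| = (#|l :&: Y| + #|l :&: (X :\: Y)|)%N.
  move=> sYX; rewrite -(cardsID Y (l :&: X)) -finset.setIA (finset.setIidPr sYX).
  by congr (_ + #|pred_of_set _|)%N; apply/setP => s; rewrite !inE andbCA.
have sB' : B \subset Q :\: A by rewrite subsetD sB disjoint_sym.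
have sC' : C \subset Q :\: A :\: B by rewrite !subsetD sC !(disjoint_sym C) dAC dBC.
by rewrite (splitI _ _ sA) (splitI _ _ sB') (splitI _ _ sC') !addnA.
Qed.

(** A square counts ordered pairs of points on a line. The diagonal pairs add up to the incidences,
    and a pair of distinct points lies on at most one line of [F]. *)
Lemma sum_sq_le F Q :
  (forall l l' s t, l \in F -> l' \in F -> s != t ->
     s \in l -> t \in l -> s \in l' -> t \in l' -> l = l') ->
  sum_sq F Q <= #|Q|%:R ^+ 2 + incidences F Q.
Proof.
move=> uniF.
pose off l := [set u in finset.setX (l :&: Q) (l :&: Q) | u.1 != u.2].
have sq l : (#|l :&: Q| ^ 2 <= #|l :&: Q| + #|off l|)%N.
  pose dg := [set (s, s) | s in l :&: Q].
  have cdg : (#|dg| <= #|l :&: Q|)%N by apply: leq_imset_card.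
  have sub : finset.setX (l :&: Q) (l :&: Q) \subset dg :|: off l.
    apply/fintype.subsetP => -[s t] st; apply/finset.setUP.
    have [eq_st|neq_st] := eqVneq s t; [left | right].
      by move: st; rewrite -eq_st in_setX => /andP[sl _]; apply/imsetP; exists s.
    by rewrite inE st.
  have := leq_trans (subset_leq_card sub) (leq_card_setU _ _).
  by rewrite cardsX -mulnn; lia.
have offs : (\sum_(l in F) #|off l| <= #|Q| ^ 2)%N.
  rewrite -mulnn -cardsX -sum1_card.
  under eq_bigr do rewrite -sum1_card big_mkcond /=.
  rewrite exchange_big /= [leqRHS]big_mkcond /=; apply: leq_sum => -[s t] _.
  case: (boolP [exists l in F, (s, t) \in off l]) => [/existsP[l /andP[lF stl]]|].
    move: (stl); rewrite !inE /= => /andP[/andP[/andP[sl sQ] /andP[tl tQ]] neq].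
    rewrite sQ tQ (bigD1 l) //= stl big1 // => l' /andP[l'F neq_l].
    case: ifP => //; rewrite !inE /= => /andP[/andP[/andP[sl' _] /andP[tl' _]] _].
    by case/eqP: neq_l; apply: (uniF _ _ s t).
  move/existsPn => H; rewrite big1 // => l lF; case: ifP => // stl.
  by have := H l; rewrite lF stl.
rewrite /sum_sq /incidences.
under [X in X <= _]eq_bigr do rewrite -natrX.
rewrite -!natr_sum -natrX -natrD ler_nat.
apply: (@leq_trans (\sum_(l in F) (#|l :&: Q| + #|off l|))).
  by apply: leq_sum => l _; apply: sq.
by rewrite big_split /= addnC leq_add2r.
Qed.

(** Rescales the inductive bound on a cell of size [w] to the weight [1 / w] that the cell has in
    the Cauchy-Schwarz inequality, [N] being the size of the whole set. Only the incidence term pays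
    the ratio [N / w <= 24]. *)
Lemma sum_sq_cell (t N w c e m s i : R) : 0 <= c -> 0 <= i -> 0 < w -> 0 < N ->
  N <= 24 * w -> s <= t * w ^+ 2 + c * i + e * m * w ->
  N * (s / w) <= t * N * w + 24 * c * i + e * m * N.
Proof.
move=> c0 i0 w0 N0 Nw sle.
have -> : N * (s / w) = N * s / w by rewrite mulrA.
rewrite ler_pdivrMr //.
have h1 : N * s <= N * (t * w ^+ 2 + c * i + e * m * w) by rewrite ler_pM2l.
have h2 : 0 <= (24 * w - N) * (c * i) by rewrite mulr_ge0 ?subr_ge0 ?mulr_ge0.
lra.
Qed.

End RichPairs.

(* A line missing one of three cells of proportion [alpha] gains a factor
   [1 - alpha] in the weighted Cauchy-Schwarz inequality over the cells; the
   gain accumulates along a subdivision of constant depth [j]. *)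
Lemma sum_sq_bound (R : realFieldType) (j : nat) : exists c e N0 : nat,
  forall (T : finType) (x y : T -> R) (F : {set {set T}}) (m : nat) (Q : {set T}),
    injective x ->
    (forall l, l \in F -> exists a b, l = graph_line x y a b) ->
    (forall l, l \in F -> (#|l| <= m)%N) -> (N0 <= #|Q|)%N ->
    sum_sq R F Q <= (23 / 24) ^+ j * #|Q|%:R ^+ 2 + c%:R * incidences R F Q
      + e%:R * m%:R * #|Q|%:R.
Proof.
elim: j => [|j [c [e [N0 IH]]]].
  exists 1%N, 0%N, 0%N => T x y F m Q x_inj lines _ _.
  rewrite expr0 !mul1r !mul0r addr0; apply: sum_sq_le => l l' s t /lines[a [b ->]].
  move=> /lines[a' [b' ->]] neq_st sl tl sl' tl'.
  by have [-> ->] := graph_line_inj x_inj neq_st sl tl sl' tl'.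
(* The factor 24 is the largest ratio of [Q] to a cell; [4 * e + 1] counts four cells and the new
   exceptional line [h]; the threshold makes [#|Q| %/ 12] positive and at least [N0]. *)
exists (24 * c)%N, (4 * e + 1)%N, (24 * N0 + 12)%N.
move=> T x y F m Q x_inj lines le_m le_N0.
have [v [v0 vQ Qv vN0]] : exists v : nat,
    [/\ (0 < v), (12 * v <= #|Q|), (#|Q| <= 24 * v) & (N0 <= v)]%N.
  by exists (#|Q| %/ 12)%N; split; lia.
have [A [B [C [h [[sA sB sC] [[cA cB cC] [[dAB dAC dBC] avoid]]]]]]] :=
  line_avoiding_triple y x_inj v0 vQ.
pose D := Q :\: A :\: B :\: C.
have split4 l := @cardsI_split4 T Q A B C l sA sB sC dAB dAC dBC.
have cQ : #|Q| = (v + v + v + #|D|)%N.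
  by have := split4 finset.setT; rewrite !finset.setTI cA cB cC.
have vD : (v <= #|D|)%N by clear -cQ vQ; lia.
have D0 := leq_trans v0 vD.
have QD : (#|Q| <= 24 * #|D|)%N by apply: leq_trans Qv _; rewrite leq_mul2l.
have Q0 : (0 < #|Q|)%N by rewrite cQ addn_gt0 D0 orbT.
have hA := IH T x y F m A x_inj lines le_m; rewrite cA in hA.
have hB := IH T x y F m B x_inj lines le_m; rewrite cB in hB.
have hC := IH T x y F m C x_inj lines le_m; rewrite cC in hC.
have hD := IH T x y F m D x_inj lines le_m.
have {}hD := hD (leq_trans vN0 vD); have {}hA := hA vN0.
have {}hB := hB vN0; have {}hC := hC vN0.
have QR : #|Q|%:R = v%:R + v%:R + v%:R + #|D|%:R :> R by rewrite cQ !natrD.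
have vR : 0 < v%:R :> R by rewrite ltr0n.
have DR : 0 < #|D|%:R :> R by rewrite ltr0n.
have NR : 0 < #|Q|%:R :> R by rewrite ltr0n.
have QvR : #|Q|%:R <= 24 * v%:R :> R by rewrite -natrM ler_nat.
have QDR : #|Q|%:R <= 24 * #|D|%:R :> R by rewrite -natrM ler_nat.
have I0 X : 0 <= incidences R F X by apply: sumr_ge0.
have IQ : incidences R F Q = incidences R F A + incidences R F B
    + incidences R F C + incidences R F D.
  by rewrite /incidences -!big_split /=; apply: eq_bigr => l _; rewrite split4 !natrD.
pose w l : R := #|l :&: A|%:R ^+ 2 / v%:R + #|l :&: B|%:R ^+ 2 / v%:R
  + #|l :&: C|%:R ^+ 2 / v%:R + #|l :&: D|%:R ^+ 2 / #|D|%:R.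
have w0 l : 0 <= w l by rewrite /w !addr_ge0 ?divr_ge0 ?sqr_ge0 ?ler0n.
(* A line missing one of [A], [B], [C] has total weight [2 * v + #|D|], which is [#|Q| - v] and so
   at most 23/24 of [#|Q|]. The line [h] is bounded trivially by [m * #|Q|]. *)
have line_le l : l \in F ->
    #|l :&: Q|%:R ^+ 2 <= 23 / 24 * #|Q|%:R * w l + (l == h)%:R * (m%:R * #|Q|%:R).
  move=> lF; have [eq_lh|neq_lh] := eqVneq l h.
    rewrite mul1r -[leLHS]add0r; apply: lerD.
      by apply: mulr_ge0 (w0 l); apply: mulr_ge0 (ler0n _ _); apply: divr_ge0.
    rewrite expr2; apply: ler_pM; rewrite ?ler0n // ler_nat.
      by apply: leq_trans (le_m l lF); rewrite subset_leq_card ?subsetIl.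
    by rewrite subset_leq_card ?subsetIr.
  rewrite mul0r addr0.
  apply: (@le_trans _ _ ((2 * v%:R + #|D|%:R) * w l)); last first.
    by rewrite ler_wpM2r //; lra.
  have [a [b El]] := lines l lF; rewrite El in neq_lh.
  rewrite split4 !natrD -/D.
  have zero X : misses l X -> #|l :&: X|%:R = 0 :> R by move/eqP->; rewrite cards0.
  have := avoid _ _ neq_lh; rewrite -El => -[] /zero z; rewrite /w z.
  - have := weighted_cauchy3 #|l :&: B|%:R #|l :&: C|%:R #|l :&: D|%:R vR DR.
    by rewrite expr0n /= mul0r !add0r.
  - have := weighted_cauchy3 #|l :&: A|%:R #|l :&: C|%:R #|l :&: D|%:R vR DR.
    by rewrite expr0n /= mul0r !addr0.
  - have := weighted_cauchy3 #|l :&: A|%:R #|l :&: B|%:R #|l :&: D|%:R vR DR.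
    by rewrite expr0n /= mul0r !addr0.
have sum_w : \sum_(l in F) w l = sum_sq R F A / v%:R + sum_sq R F B / v%:R
    + sum_sq R F C / v%:R + sum_sq R F D / #|D|%:R.
  by rewrite /sum_sq !mulr_suml -!big_split.
have sum_h : \sum_(l in F) (l == h)%:R <= 1 :> R.
  have [hF|hF] := boolP (h \in F).
    by rewrite (bigD1 h) //= eqxx big1 ?addr0 // => l /andP[_ /negbTE->].
  by rewrite big1 // => l lF; case: eqP lF => // ->; rewrite (negbTE hF).
have SQ : sum_sq R F Q <= 23 / 24 * (#|Q|%:R * (\sum_(l in F) w l))
    + m%:R * #|Q|%:R.
  rewrite /sum_sq.
  apply: (@le_trans _ _ (\sum_(l in F)
    (23 / 24 * #|Q|%:R * w l + (l == h)%:R * (m%:R * #|Q|%:R)))).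
    exact: ler_sum line_le.
  rewrite big_split /= -mulr_sumr -mulr_suml [23 / 24 * (_ * _)]mulrA lerD2l.
  by rewrite -[leRHS]mul1r ler_wpM2r // mulr_ge0 ?ler0n.
have c0 : 0 <= c%:R :> R by [].
have kA := sum_sq_cell c0 (I0 A) vR NR QvR hA.
have kB := sum_sq_cell c0 (I0 B) vR NR QvR hB.
have kC := sum_sq_cell c0 (I0 C) vR NR QvR hC.
have kD := sum_sq_cell c0 (I0 D) DR NR QDR hD.
have le_sum : #|Q|%:R * (\sum_(l in F) w l) <= (23 / 24) ^+ j * #|Q|%:R ^+ 2
    + 24 * c%:R * incidences R F Q + 4 * (e%:R * m%:R * #|Q|%:R).
  rewrite sum_w 3!mulrDr; apply: le_trans (lerD (lerD (lerD kA kB) kC) kD) _.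
  rewrite le_eqVlt; apply/orP; left; apply/eqP.
  (* Only one factor of the square is expanded over the cells, since the leading term of each cell
     is [#|Q|] times the size of that cell. *)
  rewrite IQ expr2 [X in _ = _ * (_ * X) + _ + _]QR.
  by move: (_ ^+ j) (incidences _ _ _) (incidences _ _ _) (incidences _ _ _)
    (incidences _ _ _) => *; ring.
have cI0 : 0 <= 24 * c%:R * incidences R F Q by rewrite !mulr_ge0.
have em0 : 0 <= e%:R * m%:R * #|Q|%:R :> R by rewrite !mulr_ge0.
apply: (le_trans SQ); rewrite exprS -[23 / 24 * _ ^+ j * _]mulrA natrM.
have -> : (4 * e + 1)%:R * m%:R * #|Q|%:R
    = 4 * (e%:R * m%:R * #|Q|%:R) + m%:R * #|Q|%:R :> R.
  by rewrite natrD natrM -!mulrA mulrDl mul1r -mulrA.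
rewrite addrA lerD2r.
move: le_sum cI0 em0.
move: (_ * (\sum_(l in F) w l)) (_ ^+ j * _) (_ * incidences _ _ _)
  (e%:R * m%:R * _) => s1 s2 s3 s4; lra.
Qed.

Lemma expr_23_24_small (R : realFieldType) :
  exists j : nat, (23 / 24) ^+ j <= 1 / 32 :> R.
Proof.
(* The left side does not increase with [j], because [23 * (25 + j) <= 24 * (24 + j)]. *)
have B j : (23 / 24) ^+ j * (24 + j%:R) <= 24 :> R.
  elim: j => [|j IH]; first by rewrite expr0 mul1r addr0.
  have t0 : 0 <= (23 / 24) ^+ j :> R by rewrite exprn_ge0 //; lra.
  have j0 : 0 <= j%:R :> R by [].
  by apply: le_trans IH; rewrite exprSr -[j.+1%:R]natr1 -mulrA ler_wpM2l //; lra.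
(* Chosen so that [24 + j = 24 * 32]; the existential keeps the numeral from being computed. *)
have [j Ej] : exists j, j = (24 * 31)%N by exists (24 * 31)%N.
have jR : j%:R = 24 * 31 :> R by rewrite Ej natrM.
by exists j; have := B j; rewrite jR; lra.
Qed.

(** * Lines joining two sets of points, and the greedy count from a rich line *)

Definition joining_lines (R : realFieldType) (T : finType) (x y : T -> R)
    (A B : {set T}) : {set {set T}} :=
  [set span_line x y u.1 u.2 | u in finset.setX A B].

Section JoiningLines.
Variables (R : realFieldType) (T : finType) (x y : T -> R).
Implicit Types (A B : {set T}).

Lemma span_lineC s t : span_line x y s t = span_line x y t s.
Proof. by apply/setP => u; rewrite !inE; apply/eqP/eqP; lra. Qed.

Lemma joining_linesP A B l :
  reflect (exists2 s, s \in A & exists2 t, t \in B & l = span_line x y s t)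
    (l \in joining_lines x y A B).
Proof.
apply: (iffP imsetP) => [[[s t] /setXP[sA tB] ->]|[s sA [t tB ->]]].
  by exists s => //; exists t.
by exists (s, t) => //; apply/setXP.
Qed.

Lemma joining_linesC A B : joining_lines x y A B = joining_lines x y B A.
Proof.
by apply/setP => l; apply/joining_linesP/joining_linesP => -[s sA [t tB ->]];
  exists t => //; exists s => //; apply: span_lineC.
Qed.

Lemma joining_linesS A A' B B' : A \subset A' -> B \subset B' ->
  joining_lines x y A B \subset joining_lines x y A' B'.
Proof. by move=> sA sB; apply/imsetS/setXS. Qed.

(** Group the pairs by the line they span: those spanning [l] lie in the square of [l]. *)
Lemma card_setX_le_sum_sq A B :
  (#|A| * #|B| <= \sum_(l in joining_lines x y A B) #|l| ^ 2)%N.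
Proof.
rewrite -cardsX -sum1_card.
rewrite (partition_big_imset (fun u => span_line x y u.1 u.2)) /=.
apply: leq_sum => l _; rewrite sum1dep_card -mulnn -cardsX.
apply/subset_leq_card/fintype.subsetP => -[s t]; rewrite !inE /=.
by move=> /andP[_ /eqP<-]; rewrite !mem_span_line.
Qed.

Hypothesis x_inj : injective x.

(** Add the points of [Y] one by one. A new point [t0] off [l] sends distinct lines to the points of
    [X], and a line seen before goes through an earlier point of [Y]. At most [#|Y| - 1 <= #|X| / 2]
    lines repeat, so each step contributes at least [#|X| / 2] new ones. *)
Lemma card_joining_lines_rich (l X Y : {set T}) s t : s != t ->
  l = span_line x y s t -> X \subset l -> [disjoint Y & l] ->
  (2 * #|Y| <= #|X| + 2)%N -> (#|Y| * #|X| <= 2 * #|joining_lines x y X Y|)%N.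
Proof.
move=> neq_st El sX; have [k] := ubnP #|Y|; elim: k Y => // k IH Y.
have [->|[t0 t0Y]] := set_0Vmem Y; first by rewrite cards0.
move: (cardsD1 t0 Y); rewrite t0Y; set Y' := Y :\ t0 => cY lt_k dY le2.
have sY' : Y' \subset Y by apply: subD1set.
have {}IH : (#|Y'| * #|X| <= 2 * #|joining_lines x y X Y'|)%N.
  apply: IH; [lia| |lia].
  exact: disjointWl sY' dY.
have Nt0 : t0 \notin l by rewrite (disjointFr dY).
pose J := joining_lines x y X [set t0].
have neqX s' : s' \in X -> s' != t0.
  by move=> /(fintype.subsetP sX) s'l; apply: contraNneq Nt0 => <-.
have cJ : #|J| = #|X|.
  have -> : J = [set span_line x y s' t0 | s' in X].
    apply/setP => l'; apply/joining_linesP/imsetP => [[s' s'X [t']]|[s' s'X ->]].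
      by rewrite inE => /eqP-> ->; exists s'.
    by exists s' => //; exists t0; rewrite ?inE.
  apply: card_in_imset => s1 s2 s1X s2X eq_l; apply: contraNeq Nt0 => neq12.
  have -> : l = span_line x y s1 s2.
    rewrite El; apply: span_line_eq => //; rewrite -El;
    exact: (fintype.subsetP sX).
  rewrite -(@span_line_eq _ _ _ _ x_inj s1 t0) ?mem_span_line //.
    exact: neqX.
  by rewrite eq_l mem_span_line.
have cI : (#|joining_lines x y X Y' :&: J| <= #|Y'|)%N.
  apply: leq_trans (leq_imset_card (span_line x y t0) Y').
  apply/subset_leq_card/fintype.subsetP => l' /finset.setIP[].
  case/joining_linesP=> s1 s1X [t1 t1Y El'].
  case/joining_linesP=> s2 s2X [t2]; rewrite inE => /eqP-> El''.
  apply/imsetP; exists t1 => //; rewrite El''.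
  apply: span_line_eq; rewrite ?neqX ?mem_span_line //.
    by move: t1Y; rewrite !inE eq_sym => /andP[].
  by rewrite -El'' El' mem_span_line.
have := cardsUI (joining_lines x y X Y') J.
have sub : joining_lines x y X Y' :|: J \subset joining_lines x y X Y.
  by rewrite subUset !joining_linesS ?sub1set.
have := subset_leq_card sub.
nia.
Qed.

End JoiningLines.

(** * The lower bound on joining lines, without and with a rich line *)

Lemma sum_sq_rich_ge (R : realFieldType) (T : finType) (F : {set {set T}}) (k : nat) :
  (forall l, l \in F -> (k <= #|l|)%N) ->
  k%:R * incidences R F finset.setT <= sum_sq R F finset.setT.
Proof.
move=> rich; rewrite mulr_sumr; apply: ler_sum => l /rich lF.
by rewrite finset.setIT expr2 ler_wpM2r // ler_nat.
Qed.

(** The [k]-rich joining lines account for at most half of the [n ^ 2] pairs. The other pairs span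
    lines with fewer than [k] points, and each of these accounts for at most [k ^ 2] pairs. *)
Lemma many_joining_lines (R : realFieldType) : exists k e N0 : nat,
  forall (T : finType) (x y : T -> R) (A B : {set T}) (n : nat),
    injective x -> [disjoint A & B] -> #|A| = n -> #|B| = n ->
    #|T| = (2 * n)%N -> (N0 <= 2 * n)%N ->
    (forall s t, s != t -> (e * #|span_line x y s t| <= 2 * n)%N) ->
    (n ^ 2 <= 2 * k ^ 2 * #|joining_lines x y A B|)%N.
Proof.
have [j le_j] := expr_23_24_small R.
have [c [e [N0 bound]]] := sum_sq_bound R j.
(* [k = 2 * c] bounds the incidence term by half of [sum_sq]; [e'] makes the exceptional term at
   most [(2 * n) ^ 2 / 32] and is positive even if [e] is 0. *)
pose k := (2 * c)%N; pose e' := (32 * e + 1)%N; exists k, e', N0.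
move=> T x y A B n x_inj dAB cA cB cT leN0 poor.
have neqAB s t : s \in A -> t \in B -> s != t.
  by move=> sA tB; apply: contraTneq tB => <-; rewrite (disjointFr dAB).
set J := joining_lines x y A B.
pose F := [set l in J | (k <= #|l|)%N].
pose m := ((2 * n) %/ e')%N.
have FJ l : l \in F -> exists2 s, s \in A & exists2 t, t \in B & l = span_line x y s t.
  by rewrite inE => /andP[/joining_linesP].
have rich l : l \in F -> (k <= #|l|)%N by rewrite inE => /andP[].
have := bound T x y F m finset.setT x_inj.
rewrite cardsT cT => /(_ _ _ leN0) H.
have {H} : sum_sq R F finset.setT <= (23 / 24) ^+ j * (2 * n)%:R ^+ 2
    + c%:R * incidences R F finset.setT + e%:R * m%:R * (2 * n)%:R.
  apply: H => l /FJ[s sA [t tB ->]].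
    by have [a [b ->]] := span_lineP y x_inj (neqAB _ _ sA tB); exists a, b.
  have e'0 : (0 < e')%N by rewrite /e' addn1.
  by rewrite leq_divRL // mulnC; apply: poor; apply: neqAB.
have le_em : e%:R * m%:R * (2 * n)%:R <= 1 / 32 * (2 * n)%:R ^+ 2 :> R.
  have : (32 * (e * m) <= 2 * n)%N.
    apply: leq_trans (leq_trunc_div (2 * n) e').
    by rewrite -/m mulnA mulnC leq_mul2l /e' leq_addr orbT.
  rewrite -(ler_nat R) !natrM => le32.
  rewrite expr2 mulrA ler_wpM2r ?mulr_ge0 //; lra.
have le_I : 2 * (c%:R * incidences R F finset.setT) <= sum_sq R F finset.setT.
  by rewrite mulrA -natrM; apply: sum_sq_rich_ge.
have le_t : (23 / 24) ^+ j * (2 * n)%:R ^+ 2 <= 1 / 32 * (2 * n)%:R ^+ 2 :> R.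
  by rewrite ler_wpM2r // sqr_ge0.
move=> le_S.
(* Half of [sum_sq] is absorbed on the left, and the two remaining terms are at most 1/32 each. The
   result [(2 * n) ^ 2 / 8] is [n ^ 2 / 2]. *)
have {le_S} : sum_sq R F finset.setT <= 1 / 8 * (2 * n)%:R ^+ 2.
  move: (le_trans le_S (lerD (lerD le_t (lexx _)) le_em)) le_I.
  by move: (sum_sq _ _ _) (c%:R * _) (_ ^+ 2) => S I N; lra.
have -> : sum_sq R F finset.setT = (\sum_(l in F) #|l| ^ 2)%:R.
  by rewrite natr_sum; apply: eq_bigr => l _; rewrite finset.setIT natrX.
move=> le_S.
have {}le_S : (2 * (\sum_(l in F) #|l| ^ 2) <= n ^ 2)%N.
  rewrite -(ler_nat R) natrM natrX; move: le_S; rewrite natrM exprMn; lra.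
have := card_setX_le_sum_sq x y A B; rewrite cA cB -/J mulnn.
rewrite (bigID (fun l : {set T} => (k <= #|l|)%N)) /=.
have -> : (\sum_(l in J | k <= #|l|) #|l| ^ 2 = \sum_(l in F) #|l| ^ 2)%N.
  by apply: eq_bigl => l; rewrite inE.
have : (\sum_(l in J | ~~ (k <= #|l|)) #|l| ^ 2 <= k ^ 2 * #|J|)%N.
  rewrite mulnC -sum_nat_const big_mkcondr /=; apply: leq_sum => l _.
  by case: (leqP k #|l|) => //= lt_k; rewrite leq_exp2r // ltnW.
move=> le2 leN; rewrite -mulnA.
move: (leq_trans leN (leq_add (leqnn _) le2)) le_S.
by move: (k ^ 2 * _)%N (n ^ 2)%N (bigop _ _ _); clear; lia.
Qed.

(** The greedy count applies to at most [#|X| %/ 2 + 1] points of [Y]. If [Y] is that small, all of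
    it is used, and [2 * n - #|l| <= 2 * #|Y|] gives the term [4 * e]. Otherwise the count is
    quadratic in [#|X| >= n / e], which gives [8 * e ^ 2]. *)
Lemma joining_lines_of_rich_line (R : realFieldType) (T : finType) (x y : T -> R)
    (A B : {set T}) (n e : nat) s t : injective x -> s != t ->
  let l := span_line x y s t in
  #|B| = n -> (2 * n <= e * #|l|)%N ->
  (#|l| <= 2 * #|l :&: A|)%N -> (2 * #|l :&: B| <= #|l|)%N ->
  (n * (2 * n - #|l|) <= (8 * e ^ 2 + 4 * e) * #|joining_lines x y A B|)%N.
Proof.
move=> x_inj neq_st l cB le_e leA leB.
pose X := l :&: A; pose Y := B :\: l.
have cY : (#|Y| = n - #|l :&: B|)%N by rewrite cardsD cB finset.setIC.
have le_lX : (#|l| <= 2 * #|X|)%N by [].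
have le_mY : (minn #|Y| (#|X| %/ 2).+1 <= #|Y|)%N by apply: geq_minl.
have [Y' sY' cY'] := subset_of_card R le_mY.
have sJ : joining_lines x y X Y' \subset joining_lines x y A B.
  apply: joining_linesS; first exact: subsetIr.
  by apply: fintype.subset_trans sY' (subsetDl _ _).
have dY' : [disjoint Y' & l].
  apply: disjointWl sY' _; rewrite -setI_eq0; apply/eqP/setP => u.
  rewrite finset.in_setI finset.in_setD finset.in_set0.
  by case: (u \in l); rewrite ?andbF.
have := @card_joining_lines_rich R T x y x_inj l X Y' s t neq_st erefl.
rewrite subsetIl => /(_ isT dY'); rewrite cY'.
have := subset_leq_card sJ.
move: le_lX cY leB le_e; move: #|joining_lines x y A B| #|joining_lines x y X Y'|.
move: #|X| #|Y| #|l| #|l :&: B| => a d r b J J' le_lX cY leB le_e leJ.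
have le_n : (n <= e * a)%N by nia.
have le_2n : (2 * n - r <= 2 * d)%N by lia.
case: (leqP d (a %/ 2).+1) => [le_d|lt_d].
  move=> /(_ ltac:(lia)) H.
  apply: (@leq_trans (e * a * (2 * d))); first exact: leq_mul.
  nia.
move=> /(_ ltac:(lia)) H.
have h1 : (a <= 2 * (a %/ 2).+1)%N by lia.
have h2 : (a * a <= 4 * J)%N by nia.
apply: (@leq_trans (e * a * (2 * (e * a)))).
  by apply: leq_mul => //; lia.
have : (e * e * (a * a) <= e * e * (4 * J))%N by rewrite leq_mul2l h2 orbT.
nia.
Qed.

Lemma joining_lines_lower_bound (R : realFieldType) : exists D : nat,
  (0 < D)%N /\ forall (T : finType) (x y : T -> R) (A B : {set T}) (n r : nat),
    injective x -> [disjoint A & B] -> #|A| = n -> #|B| = n ->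
    #|T| = (2 * n)%N -> (0 < n)%N ->
    (forall s t, s != t -> (#|span_line x y s t| <= r)%N) ->
    (exists s t, s != t /\ #|span_line x y s t| = r) ->
    (n * (2 * n - r) <= D * #|joining_lines x y A B|)%N.
Proof.
have [k [e [N0 many]]] := many_joining_lines R.
(* One summand for each case: few points, where a single joining line suffices; no rich line; a rich
   line. The final 1 makes the constant positive. *)
exists (N0 ^ 2 + 4 * k ^ 2 + (8 * e ^ 2 + 4 * e) + 1)%N; split; first lia.
move=> T x y A B n r x_inj dAB cA cB cT n0 ub [s [t [neq_st cl]]].
set J := #|_|.
have le_nr : (n * (2 * n - r) <= 2 * n ^ 2)%N by nia.
case: (leqP N0 (2 * n)) => leN0; last first.
  have J0 : (0 < J)%N.
    have /card_gt0P[s0 s0A] : (0 < #|A|)%N by rewrite cA.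
    have /card_gt0P[t0 t0B] : (0 < #|B|)%N by rewrite cB.
    apply/card_gt0P; exists (span_line x y s0 t0).
    by apply/joining_linesP; exists s0 => //; exists t0.
  apply: (leq_trans le_nr).
  apply: (@leq_trans (N0 ^ 2 * J)); last by rewrite leq_mul2r; lia.
  apply: (@leq_trans (N0 ^ 2)); last by rewrite leq_pmulr.
  by nia.
case: (leqP (e * r) (2 * n)) => le_er.
  have le_n2 : (n ^ 2 <= 2 * k ^ 2 * J)%N.
    apply: (many T) => // s' t' /ub le_r.
    by apply: leq_trans le_er; rewrite leq_mul2l le_r orbT.
  apply: (leq_trans le_nr); apply: (@leq_trans (4 * k ^ 2 * J)); first lia.
  by rewrite leq_mul2r; lia.
apply: (@leq_trans ((8 * e ^ 2 + 4 * e) * J)); last by rewrite leq_mul2r; lia.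
have AB : A :|: B = finset.setT.
  apply/eqP; rewrite eqEcard finset.subsetT cardsT cT cardsU.
  by rewrite (disjoint_setI0 dAB) cards0 cA cB; lia.
pose l := span_line x y s t.
have cAB : #|l| = (#|l :&: A| + #|l :&: B|)%N.
  rewrite -[in LHS](finset.setIT l) -AB finset.setIUr cardsU.
  by rewrite finset.setIACA (disjoint_setI0 dAB) finset.setI0 cards0 subn0.
rewrite -cl -/l in le_er *.
(* The colour with more points on [l] plays the role of [A]; the other one then has at least half of
   the points off [l]. *)
case: (leqP #|l :&: B| #|l :&: A|) => le_AB.
  by apply: joining_lines_of_rich_line => //;
    rewrite -/l; clear -le_er le_AB cAB; lia.
rewrite /J joining_linesC.
by apply: joining_lines_of_rich_line => //;
    rewrite -/l; clear -le_er le_AB cAB; lia.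
Qed.

(** * Transfer to the Euclidean plane *)

Lemma shear_injective (R : realFieldType) (T : finType) (x y : T -> R) :
  injective (fun s => (x s, y s)) -> exists c : R, injective (fun s => x s + c * y s).
Proof.
move=> xy_inj; pose q (u : T * T) := `|(x u.1 - x u.2) / (y u.1 - y u.2)|.
(* A collision of [s] and [t] with distinct ordinates would force [c] to be minus a quotient of
   coordinate differences, but [c] exceeds all their absolute values. *)
pose c := 1 + \sum_u q u; exists c => s t eq_st.
have lt_c : q (s, t) < c.
  have le : q (s, t) <= \sum_u q u.
    by rewrite (bigD1 (s, t)) //= lerDl sumr_ge0 // => u _; apply: normr_ge0.
  by apply: le_lt_trans le _; rewrite /c ltrDr.
have [eq_y|neq_y] := eqVneq (y s) (y t).
  apply: xy_inj; rewrite eq_y; congr (_, _).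
  by move: eq_st; rewrite eq_y; apply: addIr.
have dy : y s - y t != 0 by rewrite subr_eq0.
have Ec : c = - ((x s - x t) / (y s - y t)).
  by apply: (mulIf dy); rewrite mulNr divfK //; move: eq_st; lra.
by move: lt_c; rewrite Ec /q /= -normrN ltNge ler_norm.
Qed.

Lemma span_line_shear (R : realFieldType) (T : finType) (x y : T -> R) c s t :
  span_line (fun u => x u + c * y u) y s t = span_line x y s t.
Proof. by apply/setP => u; rewrite !inE; apply/eqP/eqP; lra. Qed.

Local Open Scope classical_set_scope.

Lemma rV2_eq (R : realType) (v w : 'rV[R]_2) :
  v 0 0 = w 0 0 -> v 0 1 = w 0 1 -> v = w.
Proof.
move=> e0 e1; apply/rowP => -[[|[|//]] lt_i].
  by rewrite (_ : Ordinal _ = 0) //; apply: val_inj.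
by rewrite (_ : Ordinal _ = 1) //; apply: val_inj.
Qed.

Lemma collinearP (R : realType) (a b c : 'rV[R]_2) : a <> b ->
  [set a + k *: (b - a) | k in [set: R]] c <->
  (b 0 0 - a 0 0) * (c 0 1 - a 0 1) = (b 0 1 - a 0 1) * (c 0 0 - a 0 0).
Proof.
move=> neq_ab; split=> [[k _ <-]|e]; first by rewrite !mxE; ring.
have [e0|neq0] := eqVneq (b 0 0) (a 0 0).
  have neq1 : b 0 1 - a 0 1 != 0.
    by rewrite subr_eq0; apply/eqP => e1; apply: neq_ab; apply: rV2_eq.
  exists ((c 0 1 - a 0 1) / (b 0 1 - a 0 1)) => //.
  apply: rV2_eq; rewrite !mxE; last by field.
  move: e; rewrite e0 !subrr mul0r mulr0 addr0 => /esym/eqP.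
  by rewrite mulf_eq0 (negbTE neq1) subr_eq0 => /eqP->.
have d0 : b 0 0 - a 0 0 != 0 by rewrite subr_eq0.
exists ((c 0 0 - a 0 0) / (b 0 0 - a 0 0)) => //.
apply: rV2_eq; rewrite !mxE; first by field.
by apply: (mulfI d0); rewrite mulrDr mulrA [_ * (_ / _)]mulrC divfK //; lra.
Qed.

Section Traces.
Variables (R : realType) (n : nat) (p q : 'I_n -> 'rV[R]_2).
Hypotheses (p_inj : injective p) (q_inj : injective q).
Hypothesis pq : forall i j, p i <> q j.

Definition point (u : 'I_n + 'I_n) : 'rV[R]_2 :=
  match u with inl i => p i | inr j => q j end.

Definition trace (L : set 'rV[R]_2) : {set 'I_n + 'I_n} :=
  [set u | `[< L (point u) >]]%SET.

Definition abscissa u := point u 0 0.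
Definition ordinate u := point u 0 1.

Definition line_of s t : set 'rV[R]_2 :=
  [set point s + k *: (point t - point s) | k in [set: R]].

Definition red : {set 'I_n + 'I_n} := [set inl i | i : 'I_n]%SET.
Definition blue : {set 'I_n + 'I_n} := [set inr i | i : 'I_n]%SET.

Lemma point_inj : injective point.
Proof.
move=> [i|i] [j|j] //=.
- by move/p_inj->.
- by move/pq.
- by move/esym/pq.
- by move/q_inj->.
Qed.

Lemma point_neq s t : s != t -> point s <> point t.
Proof. by move=> /eqP neq /point_inj. Qed.

Lemma coordinates_inj : injective (fun u => (abscissa u, ordinate u)).
Proof.
by move=> s t [e0 e1]; apply: point_inj; apply: rV2_eq.
Qed.

Lemma trace_line_of s t : s != t ->
  trace (line_of s t) = span_line abscissa ordinate s t.
Proof.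
move=> neq_st; apply/setP => u; rewrite !inE.
by apply/asboolP/eqP => /(collinearP _ (point_neq neq_st)).
Qed.

Lemma trace_is_line L s t : is_line L -> s != t -> s \in trace L -> t \in trace L ->
  trace L = span_line abscissa ordinate s t.
Proof.
move=> lL neq_st; rewrite !inE => /asboolP Ls /asboolP Lt.
by rewrite (line_through lL (point_neq neq_st) Ls Lt) -trace_line_of.
Qed.

Lemma line_ofP s t : s != t ->
  [/\ is_line (line_of s t), line_of s t (point s) & line_of s t (point t)].
Proof.
move=> neq_st; split.
- exists (point s), (point t - point s); split => //.
  by rewrite subr_eq0; apply/eqP/nesym/point_neq.
- by exists 0 => //; rewrite scale0r addr0.
- by exists 1 => //; rewrite scale1r addrC subrK.
Qed.

Lemma richness_trace L : richness p q L = #|trace L|.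
Proof.
rewrite /richness.
have -> : fset_set (points p q `&` L) = [fset point u | u in trace L]%fset.
  apply/fsetP => z; rewrite in_fset_set; last first.
    exact/finite_setIl/finite_points.
  apply/idP/imfsetP => [|[u /= uL ->]]; rewrite classical_sets.in_setE.
    move=> [[[i _ <-]|[i _ <-]] Lz]; [exists (inl i)|exists (inr i)] => //;
    by rewrite inE; apply/asboolP.
  split; last by move: uL; rewrite inE => /asboolP.
  by case: {uL} u => i /=; [left|right]; exists i.
by rewrite (card_imfset _ _ point_inj) /= -cardE.
Qed.

(** The joining lines lie in the image of the bichromatic lines under [trace], and an image has no
    more elements than its source. *)
Lemma card_bichromatic_lines_ge :
  (#|joining_lines abscissa ordinate red blue|
    <= #|` fset_set (bichromatic_lines p q)|)%N.
Proof.
set J := joining_lines _ _ _ _.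
pose B := fset_set (bichromatic_lines p q).
have sub : ([fset l | l in J] `<=` [fset trace L | L in B])%fset.
  apply/fsubsetP => l /imfsetP[l' /= /joining_linesP[s /imsetP[i _ ->]]].
  move=> [t /imsetP[j _ ->]] -> ->.
  apply/imfsetP; exists (line_of (inl i) (inr j)); last by rewrite trace_line_of.
  rewrite /= in_fset_set; last exact: finite_bichromatic_lines.
  have [lL Li Lj] := @line_ofP (inl i) (inr j) isT.
  by rewrite classical_sets.in_setE; split => //; [exists i|exists j].
have := fsubset_leq_card sub.
have -> : #|` [fset l | l in J]%fset| = #|J|.
  by rewrite (card_imfset _ _ (fun _ _ e => e)) /= -cardE.
by move/leq_trans; apply; apply: leq_imfset_card.
Qed.

End Traces.

Theorem theorem2 (R : realType) :
  exists C : R, 0 < C /\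
    forall (n : nat) (p q : 'I_n -> 'rV[R]_2) (r : nat),
      (1 <= n)%N ->
      injective p -> injective q -> (forall i j, p i <> q j) ->
      is_max_richness p q r ->
      C * (n%:R * (2 * n%:R - r%:R)) <=
        (#|` fset_set (bichromatic_lines p q)|)%:R.
Proof.
have [D [D0 bound]] := joining_lines_lower_bound R.
exists D%:R^-1; split; first by rewrite invr_gt0 ltr0n.
move=> n p q r n0 p_inj q_inj pq [[L [lL L2 Lr]] max_r].
rewrite ler_pdivrMl ?ltr0n //.
(* A shear makes the abscissae distinct, so that no two points are on a vertical line, and leaves
   all spanned index sets unchanged. *)
have [c c_inj] := shear_injective (coordinates_inj p_inj q_inj pq).
pose x u := abscissa p q u + c * ordinate p q u.
have rich s t : s != t -> (1 < #|span_line (abscissa p q) (ordinate p q) s t|)%N.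
  move=> neq_st; apply/card_gt1P; exists s, t.
  by split => //; rewrite mem_span_line.
have cT : #|{: 'I_n + 'I_n}| = (2 * n)%N by rewrite card_sum card_ord mul2n addnn.
(* Makes the truncated difference [2 * n - r] agree with the real one. *)
have le_r2n : (r <= 2 * n)%N.
  by rewrite -Lr richness_trace // -cT; apply: max_card.
have := bound _ x (ordinate p q) (red n) (blue n) n r c_inj.
have -> : joining_lines x (ordinate p q) (red n) (blue n) =
    joining_lines (abscissa p q) (ordinate p q) (red n) (blue n).
  by apply: eq_imset => u; apply: span_line_shear.
move=> H.
have {H} : (n * (2 * n - r) <= D * #|` fset_set (bichromatic_lines p q)|)%N.
  apply: leq_trans (leq_mul (leqnn D) (card_bichromatic_lines_ge p_inj q_inj pq)).
  apply: H => //.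
  - rewrite -setI_eq0; apply/eqP/setP => u; rewrite !inE.
    by apply/andP => -[/imsetP[i _ ->] /imsetP[j _]].
  - by rewrite card_imset ?card_ord // => i j [].
  - by rewrite card_imset ?card_ord // => i j [].
  - move=> s t neq_st; rewrite span_line_shear -trace_line_of // -richness_trace //.
    have [lst _ _] := line_ofP p_inj q_inj pq neq_st.
    by apply: max_r => //; rewrite richness_trace // trace_line_of //; apply: rich.
  - move: L2; rewrite richness_trace // => /card_gt1P[s [t [sL tL neq_st]]].
    exists s, t; split => //.
    by rewrite span_line_shear -(trace_is_line p_inj q_inj pq lL) // -richness_trace.
by rewrite -(ler_nat R) !natrM natrB // natrM.
Qed.
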